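(* In the uncoordinated two-user Gaussian multiple access channel with energy harvesting users, the generalized lazy online algorithm GLO, applied by each user independently, is $2$-competitive for both users: for each user, with $B>0$ bits to send, and for every energy arrival sequence $\boldsymbol\sigma$ at that user with $\mathcal T_O(\boldsymbol\sigma)<\infty$, the completion time of GLO is at most $2\,\mathcal T_O(\boldsymbol\sigma)$.
   Context: All logarithms are base 2. Model. Two users send bits to a single destination over a Gaussian multiple access channel without exchanging any information; each user chooses its rate assuming that the other uses the same power, so a user transmitting with constant power $P$ for a duration $T$ uses energy $PT$ and sends $\frac T2\log(1+2P)$ bits, irrespective of the other user. The energy arrival sequences at the two users are unrelated. Hence each user faces the following single-user problem separately. Energy arrivals at a user. An energy arrival sequence $\boldsymbol\sigma$ is a finite or infinite sequence of pairs $(t_i,E_i)$, $i=0,1,2,\dots$, with $0=t_0<t_1<t_2<\cdots$ (with $t_i\to\infty$ if the sequence is infinite) and $E_i>0$: the user receives energy $E_i$ at time $t_i$. The sequence is arbitrary (no distribution is assumed). Transmission. All $B$ bits of the user are available at time $0$. The user uses a piecewise constant nonnegative transmit power $P(t)$, $t\ge0$, with finitely many changes on any bounded time interval. By time $t$ the number of bits sent is $B(t)=\int_0^t\frac12\log(1+2P(s))\,ds$ and the energy used is $E(t)=\int_0^tP(s)\,ds$. The power profile is feasible for $\boldsymbol\sigma$ if $E(t)\le\sum_{i:\,t_i\le t}E_i$ for all $t\ge0$. The completion time of a profile is the smallest $T$ with $B(T)\ge B$ ($+\infty$ if there is none). $\mathcal T_O(\boldsymbol\sigma)$ denotes the minimum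 completion time over all power profiles feasible for $\boldsymbol\sigma$ (the optimal offline algorithm, which knows all of $\boldsymbol\sigma$ in advance; $+\infty$ if no feasible profile completes). Lazy online algorithm. At each energy arrival instant $t_i$ from its starting instant on, as long as transmission is not complete, let $\hat E_i$ be the available energy (all left over, i.e. harvested and not yet used, energy plus the new arrival $E_i$) and $\hat B_i$ the number of bits still to be transmitted. Find the minimum $T_i$ such that $\frac{T_i}2\log\left(1+\frac{2\hat E_i}{T_i}\right)=\hat B_i$, and transmit with constant power $P_i=\hat E_i/T_i$ until the next energy arrival $t_{i+1}$ (or until all bits are sent, if this happens earlier or there is no further arrival). Generalized lazy online algorithm (GLO). At each energy arrival instant $t_n$ compute $B_s(n)=\lim_{T\to\infty}\frac T2\log\left(1+\frac{2\sum_{i=0}^nE_i}{T}\right)$. If $B_s(n)\le B$, GLO transmits with zero power and waits until the next arrival instant. At the first $n$ with $B_s(n)>B$, GLO starts using the lazy online algorithm from time $t_n$ onwards, with all the energy harvested so far available and all $B$ bits still to be sent. The completion time of GLO is measured from time $0$. *)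

(* Defs.v *)
From Stdlib Require Import Reals ClassicalEpsilon.
From Coquelicot Require Import Coquelicot.
Open Scope R_scope.

Definition log2 (x : R) : R := ln x / ln 2.

(** Bits per unit of time sent by a user at constant power [p], whatever the
    other user does. *)
Definition rate (p : R) : R := / 2 * log2 (1 + 2 * p).

(** [last_index = Some N] encodes the finite sequence of pairs indexed by
    [0..N], and [None] an infinite sequence; for a finite sequence the values
    of [time] and [energy] beyond [N] are meaningless and never used. *)
Definition valid_index (last_index : option nat) (i : nat) : Prop :=
  match last_index with
  | Some N => (i <= N)%nat
  | None => True
  end.

Record arrivals := {
  last_index : option nat;
  time : nat -> R;
  energy : nat -> R;
  time_0 : time 0%nat = 0;
  time_lt : forall i, valid_index last_index (S i) -> time i < time (S i);
  time_lim : last_index = None -> is_lim_seq time p_infty;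
  energy_pos : forall i, valid_index last_index i -> 0 < energy i
}.

Definition is_arrival (sigma : arrivals) (i : nat) : Prop :=
  valid_index (last_index sigma) i.

(** The sum of the [E_i] with [t_i <= t]; only finitely many terms of the series
    are nonzero. *)
Definition harvested_by (sigma : arrivals) (t : R) : R :=
  Series (fun i =>
    if excluded_middle_informative (is_arrival sigma i /\ time sigma i <= t)
    then energy sigma i else 0).

(** Only the restriction of [P] to [t >= 0] matters.  [IsStepFun] fixes no
    convention for the values at the breakpoints. *)
Definition power_profile (P : R -> R) : Prop :=
  (forall t, 0 <= t -> 0 <= P t) /\
  (forall T, 0 <= T -> inhabited (IsStepFun P 0 T)).

Definition bits_sent (P : R -> R) (t : R) : R := RInt (fun s => rate (P s)) 0 t.

Definition energy_used (P : R -> R) (t : R) : R := RInt P 0 t.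

Definition feasible (sigma : arrivals) (P : R -> R) : Prop :=
  forall t, 0 <= t -> energy_used P t <= harvested_by sigma t.

(** [bits_sent P] is continuous for a power profile [P], so that the infimum is
    attained when the set is nonempty; it is [p_infty] otherwise. *)
Definition completion_time (B : R) (P : R -> R) : Rbar :=
  Glb_Rbar (fun T => 0 <= T /\ B <= bits_sent P T).

(** The optimal offline completion time, as an infimum; [p_infty] if no feasible
    profile completes. *)
Definition offline_time (sigma : arrivals) (B : R) : Rbar :=
  Glb_Rbar (fun T => exists P, power_profile P /\ feasible sigma P /\
                               completion_time B P = Finite T).

(** The time the lazy algorithm plans for sending [b] bits with energy [e]; [0]
    if transmission is complete.  The left-hand side of the equation is strictly
    increasing in [T > 0] when [e > 0], so the set has at most one element.  It
    is nonempty in every call made by the algorithm below with [b > 0]. *)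
Definition lazy_duration (e b : R) : R :=
  if Rle_dec b 0 then 0
  else real (Glb_Rbar (fun T => 0 < T /\ T / 2 * log2 (1 + 2 * e / T) = b)).

Definition harvested (sigma : arrivals) (n : nat) : R := sum_f_R0 (energy sigma) n.

(** Available energy and remaining bits just after arrival [s + k], when the
    lazy algorithm is started at arrival [s] with all the energy harvested so far
    and [B] bits to send. *)
Fixpoint lazy_state (sigma : arrivals) (B : R) (s k : nat) : R * R :=
  match k with
  | O => (harvested sigma s, B)
  | S k' =>
      let (e, b) := lazy_state sigma B s k' in
      let T := lazy_duration e b in
      let d := Rmin T (time sigma (s + k) - time sigma (s + k')) in
      (e - d * (e / T) + energy sigma (s + k), b - d * rate (e / T))
  end.

Definition in_slot (sigma : arrivals) (t : R) (n : nat) : Prop :=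
  is_arrival sigma n /\ time sigma n <= t /\
  (is_arrival sigma (S n) -> t < time sigma (S n)).

(** Unique for [t >= 0], by [time_0] and [time_lim]. *)
Definition slot (sigma : arrivals) (t : R) : nat :=
  epsilon (inhabits O) (in_slot sigma t).

Definition lazy_power (sigma : arrivals) (B : R) (s : nat) (t : R) : R :=
  if Rlt_dec t (time sigma s) then 0
  else
    let n := slot sigma t in
    let (e, b) := lazy_state sigma B s (n - s) in
    let T := lazy_duration e b in
    if Rlt_dec t (time sigma n + T) then e / T else 0.

Definition sendable (sigma : arrivals) (n : nat) : Rbar :=
  Lim (fun T => T / 2 * log2 (1 + 2 * harvested sigma n / T)) p_infty.

Definition glo_start (sigma : arrivals) (B : R) (n : nat) : Prop :=
  is_arrival sigma n /\ Rbar_lt B (sendable sigma n) /\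
  (forall m, (m < n)%nat -> Rbar_le (sendable sigma m) B).

Definition glo_power (sigma : arrivals) (B : R) (t : R) : R :=
  match excluded_middle_informative (exists n, glo_start sigma B n) with
  | left H =>
      lazy_power sigma B (proj1_sig (constructive_indefinite_description _ H)) t
  | right _ => 0
  end.

Definition glo_time (sigma : arrivals) (B : R) : Rbar :=
  completion_time B (glo_power sigma B).

Inductive user := user1 | user2.

(* Main.v *)
(** Write [p_k] for the power of the lazy algorithm after its [k]-th arrival,
    [H_k] for the energy harvested so far.  Planned powers never decrease, and
    by concavity of [rate] the bits obtained per unit of energy,
    [rate p / p], decrease with [p]; hence all past transmission was at least as
    efficient as the current plan, which gives [H_k * rate p_k / p_k <= B].

    If a feasible profile finishes by time [U] and [m] is the last arrival up to
    [U], then Jensen's inequality gives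
    [B <= U * rate (H_m / U) = H_m * rate (H_m / U) / (H_m / U)].  Comparing the
    two bounds, [p_m >= H_m / U], so the time planned at [m] is at most [U] and
    the planned completion instant at most [2 U]; later arrivals only bring the
    planned completion forward. *)
Require Import Defs.
From Stdlib Require Import Reals.
From Coquelicot Require Import Coquelicot.
From Stdlib Require Import Lra Lia Psatz List ClassicalEpsilon Ranalysis5.
Open Scope R_scope.

(** * Logarithm inequalities and concavity of [rate] *)

Lemma ln2_pos : 0 < ln 2.
Proof. pose proof ln_lt_2; lra. Qed.

Lemma ln_le_sub1 (x : R) : 0 < x -> ln x <= x - 1.
Proof.
  intros Hx. pose proof (exp_ineq1_le (ln x)). rewrite exp_ln in H by assumption. lra.
Qed.

Lemma ln_lt_sub1 (x : R) : 0 < x -> x <> 1 -> ln x < x - 1.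
Proof.
  intros Hx Hx1.
  assert (Hl : ln x <> 0) by (intros E; apply Hx1; apply ln_inv; [lra|lra|rewrite ln_1; exact E]).
  pose proof (exp_ineq1 (ln x) Hl). rewrite exp_ln in H by assumption. lra.
Qed.

Lemma ln_tangent_lt (x y : R) : 0 < x -> 0 < y -> x <> y -> ln y < ln x + (y - x) / x.
Proof.
  intros Hx Hy Hxy.
  assert (Hyx : 0 < y / x) by (apply Rdiv_lt_0_compat; assumption).
  assert (Hn : y / x <> 1).
  { intros E. apply Hxy. replace y with (y / x * x) by (field; lra). rewrite E. ring. }
  pose proof (ln_lt_sub1 _ Hyx Hn) as H.
  rewrite ln_div in H by assumption.
  replace ((y - x) / x) with (y / x - 1) by (field; lra). lra.
Qed.

Lemma rateE (p : R) : rate p = ln (1 + 2 * p) / (2 * ln 2).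
Proof. unfold rate, log2. pose proof ln2_pos. field. lra. Qed.

Lemma planned_bitsE (e T : R) : T / 2 * log2 (1 + 2 * e / T) = T * rate (e / T).
Proof.
  unfold rate. replace (2 * e / T) with (2 * (e / T)) by (unfold Rdiv; ring).
  unfold Rdiv; ring.
Qed.

Lemma rate_0 : rate 0 = 0.
Proof. rewrite rateE, Rmult_0_r, Rplus_0_r, ln_1. unfold Rdiv; ring. Qed.

Lemma rate_incr (p q : R) : 0 <= p -> p < q -> rate p < rate q.
Proof.
  intros Hp Hpq. rewrite !rateE. pose proof ln2_pos.
  apply Rmult_lt_compat_r; [apply Rinv_0_lt_compat; lra|].
  apply ln_increasing; lra.
Qed.

Lemma rate_pos (p : R) : 0 < p -> 0 < rate p.
Proof. intros Hp. rewrite <- rate_0. apply rate_incr; lra. Qed.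

Lemma rate_le (p q : R) : 0 <= p -> p <= q -> rate p <= rate q.
Proof.
  intros Hp [Hpq| ->]; [|lra]. apply Rlt_le, rate_incr; assumption.
Qed.

Lemma rate_tangent (p q : R) : 0 <= p -> 0 <= q ->
  rate p <= rate q + (p - q) / (ln 2 * (1 + 2 * q)).
Proof.
  intros Hp Hq. rewrite !rateE. pose proof ln2_pos as Hl.
  destruct (Req_dec p q) as [->|Hpq].
  { unfold Rminus. rewrite Rplus_opp_r. unfold Rdiv. lra. }
  assert (H : ln (1 + 2 * p) < ln (1 + 2 * q) + (1 + 2 * p - (1 + 2 * q)) / (1 + 2 * q))
    by (apply ln_tangent_lt; lra).
  replace (ln (1 + 2 * q) / (2 * ln 2) + (p - q) / (ln 2 * (1 + 2 * q)))
    with ((ln (1 + 2 * q) + (1 + 2 * p - (1 + 2 * q)) / (1 + 2 * q)) / (2 * ln 2))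
    by (field; lra).
  apply Rlt_le, Rmult_lt_compat_r; [apply Rinv_0_lt_compat; lra|exact H].
Qed.

(** A concave function vanishing at [0] has a decreasing ratio to its argument. The tangent of [ln]
    at [1 + 2 * p] is evaluated at [1 + 2 * q] and at [1]. *)
Lemma rate_chord (p q : R) : 0 < p -> p < q -> p * rate q < q * rate p.
Proof.
  intros Hp Hpq. rewrite !rateE. pose proof ln2_pos as Hl.
  assert (H1 : ln (1 + 2 * q) < ln (1 + 2 * p) + (1 + 2 * q - (1 + 2 * p)) / (1 + 2 * p))
    by (apply ln_tangent_lt; lra).
  assert (H2 : ln 1 < ln (1 + 2 * p) + (1 - (1 + 2 * p)) / (1 + 2 * p))
    by (apply ln_tangent_lt; lra).
  rewrite ln_1 in H2.
  set (w := / (1 + 2 * p)) in *.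
  replace ((1 + 2 * q - (1 + 2 * p)) / (1 + 2 * p)) with (2 * (q - p) * w) in H1
    by (unfold w; field; lra).
  replace ((1 - (1 + 2 * p)) / (1 + 2 * p)) with (- (2 * p * w)) in H2
    by (unfold w; field; lra).
  (* This is [p] times [H1] plus [q - p] times [H2]. *)
  assert (H : p * ln (1 + 2 * q) < q * ln (1 + 2 * p)) by nra.
  replace (p * (ln (1 + 2 * q) / (2 * ln 2))) with (p * ln (1 + 2 * q) * / (2 * ln 2))
    by (field; lra).
  replace (q * (ln (1 + 2 * p) / (2 * ln 2))) with (q * ln (1 + 2 * p) * / (2 * ln 2))
    by (field; lra).
  apply Rmult_lt_compat_r; [apply Rinv_0_lt_compat; lra|exact H].
Qed.

Lemma rate_chord_le (p q : R) : 0 < p -> p <= q -> p * rate q <= q * rate p.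
Proof.
  intros Hp [Hpq| ->]; [|lra]. apply Rlt_le, rate_chord; assumption.
Qed.

(** * Bits sent with a fixed energy, as a function of the duration *)

(** Spreading the same energy over a longer time lowers the power, hence yields more bits per unit
    of energy. *)
Lemma planned_bits_incr (e T U : R) : 0 < e -> 0 < T -> T < U ->
  T * rate (e / T) < U * rate (e / U).
Proof.
  intros He HT HU.
  assert (Hp : 0 < e / U) by (apply Rdiv_lt_0_compat; lra).
  assert (Hpq : e / U < e / T)
    by (apply Rmult_lt_compat_l; [lra|apply Rinv_lt_contravar; [nra|lra]]).
  pose proof (rate_chord _ _ Hp Hpq) as H.
  apply (Rmult_lt_compat_r (T * U / e)) in H; [|apply Rdiv_lt_0_compat; nra].
  replace (e / U * rate (e / T) * (T * U / e)) with (T * rate (e / T)) in H by (field; lra).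
  replace (e / T * rate (e / U) * (T * U / e)) with (U * rate (e / U)) in H by (field; lra).
  exact H.
Qed.

(** Uses [1 + x <= (1 + sqrt x)^2]. It bounds [T * rate (e / T)] by a multiple of [sqrt T], which
    vanishes as [T] tends to [0]. *)
Lemma ln_1p_le_sqrt (x : R) : 0 <= x -> ln (1 + x) <= 2 * sqrt x.
Proof.
  intros Hx.
  assert (Hs : 0 <= sqrt x) by apply sqrt_pos.
  assert (H : ln (1 + x) <= ln ((1 + sqrt x) * (1 + sqrt x))).
  { apply ln_le; [lra|]. pose proof (sqrt_sqrt x Hx). nra. }
  rewrite ln_mult in H by lra.
  pose proof (ln_le_sub1 (1 + sqrt x)). lra.
Qed.

Lemma planned_bits_small (e b : R) : 0 < e -> 0 < b ->
  exists T, 0 < T /\ T * rate (e / T) < b.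
Proof.
  intros He Hb. pose proof ln2_pos as Hl.
  set (x := b * ln 2 / 2).
  assert (Hx : 0 < x) by (unfold x; nra).
  assert (HT : 0 < x * x / (2 * e)) by (apply Rdiv_lt_0_compat; nra).
  (* This duration makes [2 * e / T] the square of [2 * e / x]; the square root bound then equals
     [x / ln 2], which is [b / 2]. *)
  exists (x * x / (2 * e)). split; [exact HT|].
  assert (E : 2 * (e / (x * x / (2 * e))) = (2 * e / x) * (2 * e / x)) by (field; lra).
  assert (Hy : 0 <= 2 * e / x) by (apply Rlt_le, Rdiv_lt_0_compat; lra).
  rewrite rateE, E.
  pose proof (ln_1p_le_sqrt ((2 * e / x) * (2 * e / x))) as H.
  rewrite sqrt_square in H by exact Hy.
  assert (H' := H (Rmult_le_pos _ _ Hy Hy)).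
  apply (Rmult_le_compat_l (x * x / (2 * e) / (2 * ln 2))) in H';
    [|apply Rlt_le, Rdiv_lt_0_compat; lra].
  replace (x * x / (2 * e) / (2 * ln 2) * (2 * (2 * e / x))) with (b / 2) in H'
    by (unfold x; field; lra).
  replace (x * x / (2 * e) * (ln (1 + 2 * e / x * (2 * e / x)) / (2 * ln 2)))
    with (x * x / (2 * e) / (2 * ln 2) * ln (1 + 2 * e / x * (2 * e / x)))
    by (field; lra).
  lra.
Qed.

Lemma planned_bits_continuous (e T : R) : 0 < e -> 0 < T ->
  continuity_pt (fun U => U * rate (e / U)) T.
Proof.
  intros He HT. apply continuity_pt_filterlim.
  refine (ex_derive_continuous (V := R_NormedModule) (fun U : R => U * rate (e / U)) T _).
  pose proof ln2_pos. unfold rate, log2. auto_derive.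
  assert (0 < e / T) by (apply Rdiv_lt_0_compat; lra).
  unfold Rdiv in *. repeat split; lra.
Qed.

(** Any duration [U] in which energy [e] suffices for [b] bits makes the lazy equation solvable, by
    the intermediate value theorem on an interval from a very short duration to [U]. Strict
    monotonicity makes the solution unique, so the infimum in [lazy_duration] is that solution. *)
Lemma lazy_duration_spec (e b U : R) : 0 < e -> 0 < b -> 0 < U ->
  b <= U * rate (e / U) ->
  0 < lazy_duration e b <= U /\
  lazy_duration e b * rate (e / lazy_duration e b) = b.
Proof.
  intros He Hb HU HbU.
  assert (HT : exists T, 0 < T <= U /\ T * rate (e / T) = b).
  { destruct HbU as [HbU|HbU]; [|exists U; split; [lra|auto]].
    destruct (planned_bits_small e b He Hb) as [T0 [HT0 Hb0]].
    assert (HTU : T0 < U).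
    { destruct (Rlt_le_dec T0 U) as [|[Hlt|Heq]]; [assumption| |subst; lra].
      pose proof (planned_bits_incr e U T0 He HU Hlt). lra. }
    destruct (IVT_interv (fun T => T * rate (e / T) - b) T0 U) as [T [[H1 H2] H3]];
      [|exact HTU|lra|lra|].
    - intros a Ha. apply continuity_pt_minus.
      + apply planned_bits_continuous; lra.
      + apply continuity_pt_const. intros ? ?; reflexivity.
    - exists T. split; lra. }
  destruct HT as [T [HT Heq]].
  assert (E : lazy_duration e b = T).
  { unfold lazy_duration. destruct (Rle_dec b 0); [lra|].
    replace T with (real (Finite T)) by reflexivity. f_equal.
    apply is_glb_Rbar_unique. split.
    - intros V [HV EV]. rewrite planned_bitsE in EV. simpl.
      destruct (Rle_lt_dec T V) as [|Hlt]; [assumption|].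
      pose proof (planned_bits_incr e V T He HV Hlt). lra.
    - intros l Hl. apply Hl. rewrite planned_bitsE. split; [lra|assumption]. }
  rewrite E. split; assumption.
Qed.

(** Squeezes with [x / (1 + x) <= ln (1 + x) <= x] at [x = 2 * h / T]. *)
Lemma planned_bits_lim (h : R) : 0 < h ->
  is_lim (fun T => T / 2 * log2 (1 + 2 * h / T)) p_infty (h / ln 2).
Proof.
  intros Hh. pose proof ln2_pos as Hl.
  apply is_lim_le_le_loc with (f := fun T => h / ln 2 * (/ (1 + 2 * h * / T)))
                              (g := fun _ => h / ln 2).
  - exists 0. intros T HT. rewrite planned_bitsE, rateE.
    assert (Hp : 0 < h / T) by (apply Rdiv_lt_0_compat; lra).
    split.
    + pose proof (ln_tangent_lt (1 + 2 * (h / T)) 1 ltac:(lra) ltac:(lra) ltac:(lra)) as H.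
      rewrite ln_1 in H.
      replace (T * (ln (1 + 2 * (h / T)) / (2 * ln 2)))
        with (T / (2 * ln 2) * ln (1 + 2 * (h / T))) by (field; lra).
      replace (h / ln 2 * / (1 + 2 * h * / T))
        with (T / (2 * ln 2) * (- ((1 - (1 + 2 * (h / T))) / (1 + 2 * (h / T)))))
        by (field; unfold Rdiv in Hp; repeat split; nra).
      apply Rmult_le_compat_l; [apply Rlt_le, Rdiv_lt_0_compat; lra|lra].
    + pose proof (ln_le_sub1 (1 + 2 * (h / T)) ltac:(lra)) as H.
      replace (T * (ln (1 + 2 * (h / T)) / (2 * ln 2)))
        with (T / (2 * ln 2) * ln (1 + 2 * (h / T))) by (field; lra).
      replace (h / ln 2) with (T / (2 * ln 2) * (1 + 2 * (h / T) - 1)) by (field; lra).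
      apply Rmult_le_compat_l; [apply Rlt_le, Rdiv_lt_0_compat; lra|lra].
  - replace (Finite (h / ln 2)) with (Rbar_mult (h / ln 2) (/ (1 + 2 * h * 0))).
    2:{ simpl. f_equal. field. lra. }
    apply is_lim_scal_l.
    replace (Finite (/ (1 + 2 * h * 0))) with (Rbar_inv (1 + 2 * h * 0)) by reflexivity.
    apply is_lim_inv.
    2:{ intros E. apply Rbar_finite_eq in E. lra. }
    apply is_lim_plus'; [apply is_lim_const|].
    replace (Finite (2 * h * 0)) with (Rbar_mult (2 * h) (Rbar_inv p_infty))
      by (simpl; f_equal).
    apply is_lim_scal_l. apply is_lim_inv; [apply is_lim_id|discriminate].
  - apply is_lim_const.
Qed.

Lemma sendable_eq (sigma : arrivals) (n : nat) : 0 < harvested sigma n ->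
  sendable sigma n = Finite (harvested sigma n / ln 2).
Proof. intros Hh. apply is_lim_unique, planned_bits_lim, Hh. Qed.

Lemma planned_bits_lt_sendable (h T : R) : 0 < h -> 0 < T -> T * rate (h / T) < h / ln 2.
Proof.
  intros Hh HT. pose proof ln2_pos as Hl. rewrite rateE.
  assert (Hp : 0 < h / T) by (apply Rdiv_lt_0_compat; lra).
  pose proof (ln_lt_sub1 (1 + 2 * (h / T)) ltac:(lra) ltac:(lra)) as H.
  replace (T * (ln (1 + 2 * (h / T)) / (2 * ln 2)))
    with (T / (2 * ln 2) * ln (1 + 2 * (h / T))) by (field; lra).
  replace (h / ln 2) with (T / (2 * ln 2) * (1 + 2 * (h / T) - 1)) by (field; lra).
  apply Rmult_lt_compat_l; [apply Rdiv_lt_0_compat; lra|lra].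
Qed.

(** Turns the starting condition of GLO into solvability of the first lazy equation. *)
Lemma lt_sendable_planned_bits (h b : R) : 0 < h -> b < h / ln 2 ->
  exists T, 0 < T /\ b <= T * rate (h / T).
Proof.
  intros Hh Hb.
  assert (He : 0 < h / ln 2 - b) by lra.
  pose proof (planned_bits_lim h Hh) as HL. apply is_lim_spec in HL.
  destruct (HL (mkposreal _ He)) as [M HM]; simpl in HM.
  exists (Rmax M 0 + 1).
  assert (HT : M < Rmax M 0 + 1 /\ 0 < Rmax M 0 + 1)
    by (pose proof (Rmax_l M 0); pose proof (Rmax_r M 0); lra).
  split; [apply HT|]. specialize (HM _ (proj1 HT)). rewrite planned_bitsE in HM.
  apply Rabs_def2 in HM. lra.
Qed.

(** * Arrival sequences, slots and harvested energy *)

Section Arrivals.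

Variable sigma : arrivals.

Lemma is_arrival_le (i j : nat) : (i <= j)%nat -> is_arrival sigma j -> is_arrival sigma i.
Proof.
  unfold is_arrival, valid_index. destruct (last_index sigma); intros; [lia|trivial].
Qed.

Lemma time_le (i j : nat) : is_arrival sigma j -> (i <= j)%nat ->
  time sigma i <= time sigma j.
Proof.
  intros Hj Hij. induction Hij as [|j Hij IH]; [lra|].
  pose proof (time_lt sigma j Hj).
  pose proof (IH (is_arrival_le j (S j) (Nat.le_succ_diag_r j) Hj)). lra.
Qed.

Lemma time_nonneg (j : nat) : is_arrival sigma j -> 0 <= time sigma j.
Proof. intros Hj. rewrite <- (time_0 sigma). apply time_le; [exact Hj|lia]. Qed.

Lemma harvested_pos (n : nat) : is_arrival sigma n -> 0 < harvested sigma n.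
Proof.
  induction n as [|n IH]; intros Hn; unfold harvested; simpl.
  - apply energy_pos, Hn.
  - pose proof (energy_pos sigma (S n) Hn).
    specialize (IH (is_arrival_le n (S n) (Nat.le_succ_diag_r n) Hn)).
    unfold harvested in IH. lra.
Qed.

Lemma in_slot_iff (t : R) (n i : nat) : in_slot sigma t n ->
  (is_arrival sigma i /\ time sigma i <= t <-> (i <= n)%nat).
Proof.
  intros [Hn [Ht Hlt]]. split.
  - intros [Hi Hit]. destruct (Nat.le_gt_cases i n) as [|Hgt]; [assumption|].
    pose proof (Hlt (is_arrival_le (S n) i Hgt Hi)).
    pose proof (time_le (S n) i Hi Hgt). lra.
  - intros Hin. split; [exact (is_arrival_le i n Hin Hn)|].
    pose proof (time_le i n Hn Hin). lra.
Qed.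

Lemma slot_unique (t : R) (n : nat) : in_slot sigma t n -> slot sigma t = n.
Proof.
  intros Hn.
  assert (Hs : in_slot sigma t (slot sigma t))
    by exact (epsilon_spec (inhabits O) (in_slot sigma t) (ex_intro _ n Hn)).
  pose proof (proj1 (in_slot_iff t n (slot sigma t) Hn)).
  pose proof (proj1 (in_slot_iff t (slot sigma t) n Hs)).
  destruct Hn as [? [? ?]], Hs as [? [? ?]].
  apply Nat.le_antisymm; auto.
Qed.

(** Some index is not an arrival up to [t], by finiteness or by divergence of [time]. Descending
    from it reaches the last arrival up to [t], at the latest arrival [0]. *)
Lemma in_slot_exists (t : R) : 0 <= t -> exists n, in_slot sigma t n.
Proof.
  intros Ht.
  assert (Hex : exists n, ~ (is_arrival sigma n /\ time sigma n <= t)).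
  { destruct (last_index sigma) as [N|] eqn:E.
    - exists (S N). intros [H _]. unfold is_arrival, valid_index in H.
      rewrite E in H. lia.
    - pose proof (time_lim sigma E) as HL. apply is_lim_seq_spec in HL.
      destruct (HL t) as [N HN]. exists N. intros [_ H].
      specialize (HN N (Nat.le_refl N)). lra. }
  destruct Hex as [n Hn]. induction n as [|n IH].
  - exfalso. apply Hn. split; [|rewrite time_0; exact Ht].
    unfold is_arrival, valid_index. destruct (last_index sigma); [lia|trivial].
  - destruct (excluded_middle_informative (is_arrival sigma n /\ time sigma n <= t))
      as [[H1 H2]|H]; [|exact (IH H)].
    exists n. repeat split; try assumption.
    intros HS. apply Rnot_le_lt. intros Hle. apply Hn. split; assumption.
Qed.

Lemma harvested_by_slot (t : R) (n : nat) : in_slot sigma t n ->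
  harvested_by sigma t = harvested sigma n.
Proof.
  intros Hn. unfold harvested_by. apply is_series_unique.
  set (a := fun i => if excluded_middle_informative _ then _ else _).
  assert (Ha : forall k, sum_n a (n + k) = harvested sigma n).
  { induction k as [|k IH].
    - rewrite Nat.add_0_r, sum_n_Reals. apply sum_eq. intros i Hi. unfold a.
      destruct (excluded_middle_informative _) as [_|H]; [reflexivity|].
      exfalso. apply H, (in_slot_iff t n i Hn), Hi.
    - rewrite Nat.add_succ_r, sum_Sn, IH. unfold a at 1.
      destruct (excluded_middle_informative _) as [H|_].
      + apply (in_slot_iff t n _ Hn) in H. lia.
      + exact (plus_zero_r (G := R_AbelianMonoid) _). }
  apply filterlim_ext_loc with (fun _ : nat => harvested sigma n).
  - exists n. intros m Hm. rewrite <- (Ha (m - n)%nat). f_equal. lia.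
  - apply filterlim_const.
Qed.

End Arrivals.

(** * Integrating power profiles, and the bound on offline bits *)

Lemma IsStepFun_comp (h f : R -> R) (a b : R) :
  IsStepFun f a b -> IsStepFun (fun x => h (f x)) a b.
Proof.
  intros [l [lf [H1 [H2 [H3 [H4 H5]]]]]].
  exists l, (map h lf). repeat split; try assumption.
  - rewrite length_map. exact H4.
  - intros i Hi x Hx. rewrite (H5 i Hi x Hx).
    assert (Hl : (i < length lf)%nat) by lia.
    clear - Hl. revert i Hl. induction lf as [|y lf IH]; intros i Hl; simpl in *; [lia|].
    destruct i; [reflexivity|]. apply IH. lia.
Qed.

Lemma IsStepFun_ex_RInt (f : R -> R) (a b : R) : IsStepFun f a b -> ex_RInt f a b.
Proof.
  intros Hf. apply ex_RInt_Reals_1. intros eps.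
  (* A step function approximates itself with error function zero. *)
  exists (mkStepFun Hf), (mkStepFun (StepFun_P4 a b 0)). split.
  - intros t _. simpl. unfold fct_cte. rewrite Rminus_diag_eq, Rabs_R0 by reflexivity. lra.
  - rewrite StepFun_P18, Rmult_0_l, Rabs_R0. apply cond_pos.
Qed.

(* Jensen's inequality, through the tangent of [rate] at the mean power. *)
Lemma bits_sent_le (P : R -> R) (T h : R) : power_profile P -> 0 < T -> 0 < h ->
  energy_used P T <= h -> bits_sent P T <= T * rate (h / T).
Proof.
  intros [Hpos Hstep] HT Hh He. pose proof ln2_pos as Hl.
  set (q := h / T). assert (Hq : 0 < q) by (apply Rdiv_lt_0_compat; assumption).
  set (c := / (ln 2 * (1 + 2 * q))).
  assert (Hc : 0 < c) by (apply Rinv_0_lt_compat; nra).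
  destruct (Hstep T (Rlt_le _ _ HT)) as [Hs].
  pose proof (IsStepFun_ex_RInt _ _ _ Hs) as HI.
  pose proof (IsStepFun_ex_RInt _ _ _ (IsStepFun_comp rate _ _ _ Hs)) as HrI.
  assert (Hb : is_RInt (fun s => rate q - c * q + c * P s) 0 T
                 ((T - 0) * (rate q - c * q) + c * energy_used P T)).
  { apply (is_RInt_plus (V := R_NormedModule)).
    - apply (is_RInt_const (V := R_NormedModule)).
    - apply (is_RInt_scal (V := R_NormedModule)), (RInt_correct (V := R_CompleteNormedModule)), HI. }
  assert (Hle : bits_sent P T <= (T - 0) * (rate q - c * q) + c * energy_used P T).
  { refine (is_RInt_le _ _ 0 T _ _ (Rlt_le _ _ HT) (RInt_correct _ _ _ HrI) Hb _).
    intros s Hs'. pose proof (rate_tangent (P s) q (Hpos s (Rlt_le _ _ (proj1 Hs'))) (Rlt_le _ _ Hq)).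
    unfold c. unfold Rdiv in H. lra. }
  assert (Hqh : T * q = h) by (unfold q; field; lra).
  nra.
Qed.

(** * Invariants and completion of the lazy algorithm *)

Section Lazy.

Variables (sigma : arrivals) (B : R) (s : nat).
Hypothesis B_pos : 0 < B.
Hypothesis B_sendable : B < harvested sigma s / ln 2.

(** State and plan at the [k]-th arrival after the start [s]; [d k] is the time actually spent
    transmitting before the next arrival. *)
Let e k := fst (lazy_state sigma B s k).
Let b k := snd (lazy_state sigma B s k).
Let T k := lazy_duration (e k) (b k).
Let p k := e k / T k.
Let t k := time sigma (s + k).
Let d k := Rmin (T k) (t (S k) - t k).

Lemma lazy_energyS (k : nat) : e (S k) = e k - d k * p k + energy sigma (s + S k).
Proof.
  unfold d, p, T, e, b, t. simpl. destruct (lazy_state sigma B s k); reflexivity.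
Qed.

Lemma lazy_bitsS (k : nat) : b (S k) = b k - d k * rate (p k).
Proof.
  unfold d, p, T, e, b, t. simpl. destruct (lazy_state sigma B s k); reflexivity.
Qed.

Lemma lazy_duration_done (e0 b0 : R) : b0 <= 0 -> lazy_duration e0 b0 = 0.
Proof. intros H. unfold lazy_duration. destruct (Rle_dec b0 0); [reflexivity|lra]. Qed.

Lemma lazy_power_slot (k : nat) (x : R) : in_slot sigma x (s + k) ->
  lazy_power sigma B s x = if Rlt_dec x (t k + T k) then p k else 0.
Proof.
  intros Hx. pose proof Hx as [Ha [Hle _]]. unfold lazy_power.
  pose proof (time_le sigma s (s + k) Ha (Nat.le_add_r s k)).
  destruct (Rlt_dec x (time sigma s)); [lra|].
  rewrite (slot_unique sigma x _ Hx).
  replace (s + k - s)%nat with k by lia.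
  unfold p, T, e, b, t. destruct (lazy_state sigma B s k); reflexivity.
Qed.

(** Power is [p k] up to [t k + m], then zero. The endpoint [x = t (S k)] is allowed although it
    lies in the next slot, since an integral ignores endpoints. *)
Lemma lazy_slot_RInt (k : nat) (x : R) : is_arrival sigma (s + k) ->
  t k <= x -> (is_arrival sigma (s + S k) -> x <= t (S k)) -> 0 <= T k ->
  is_RInt (fun y => rate (lazy_power sigma B s y)) (t k) x
    (Rmin (T k) (x - t k) * rate (p k)).
Proof.
  intros Ha Hx Hn HT. set (m := Rmin (T k) (x - t k)).
  assert (Hm0 : 0 <= m) by (apply Rmin_glb; lra).
  assert (HmT : m <= T k) by apply Rmin_l.
  assert (Hmx : m <= x - t k) by apply Rmin_r.
  assert (Hslot : forall y, t k < y < x -> in_slot sigma y (s + k)).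
  { intros y Hy. split; [exact Ha|]. split; [unfold t in Hy; lra|].
    rewrite <- Nat.add_succ_r. intros HS. specialize (Hn HS). unfold t in *. lra. }
  replace (m * rate (p k)) with (plus ((t k + m - t k) * rate (p k)) ((x - (t k + m)) * rate 0)).
  2:{ rewrite rate_0. unfold plus; simpl. ring. }
  apply (is_RInt_Chasles (V := R_NormedModule)) with (t k + m).
  - eapply is_RInt_ext; [|apply (is_RInt_const (V := R_NormedModule))].
    intros y Hy. rewrite Rmin_left, Rmax_right in Hy by lra.
    rewrite (lazy_power_slot k) by (apply Hslot; lra).
    destruct (Rlt_dec y (t k + T k)); [reflexivity|lra].
  - eapply is_RInt_ext; [|apply (is_RInt_const (V := R_NormedModule))].
    intros y Hy. rewrite Rmin_left, Rmax_right in Hy by lra.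
    rewrite (lazy_power_slot k) by (apply Hslot; lra).
    destruct (Rlt_dec y (t k + T k)) as [Hlt|]; [|reflexivity].
    exfalso. unfold m, Rmin in Hy. destruct (Rle_dec (T k) (x - t k)); lra.
Qed.

(* The last inequality says that the bits already sent cost at most as much
   energy per bit as the current power [p k]. *)
Definition lazy_running (k : nat) : Prop :=
  0 < b k /\ 0 < e k <= harvested sigma (s + k) /\ 0 < T k /\
  T k * rate (p k) = b k /\
  (harvested sigma (s + k) - e k) * rate (p k) <= (B - b k) * p k.

(** At the start nothing has been spent or sent, so both sides of the efficiency inequality
    vanish. *)
Lemma lazy_running_0 : is_arrival sigma s -> lazy_running 0.
Proof.
  intros Hs. pose proof (harvested_pos sigma s Hs) as Hh.
  destruct (lt_sendable_planned_bits _ _ Hh B_sendable) as [U [HU HbU]].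
  destruct (lazy_duration_spec _ _ _ Hh B_pos HU HbU) as [H1 H2].
  unfold lazy_running, p, T, e, b; simpl. rewrite Nat.add_0_r.
  repeat split; try lra.
Qed.

(** With the new energy the old completion instant is still reachable, at a power no smaller than
    [p k]. The new plan therefore ends no later and uses at least the power [p k], which preserves
    the efficiency inequality. *)
Lemma lazy_running_S (k : nat) : is_arrival sigma (s + S k) -> lazy_running k ->
  b (S k) = 0 \/ lazy_running (S k) /\ t (S k) + T (S k) <= t k + T k.
Proof.
  intros Ha [Hb [He [HT [HTb Hinv]]]].
  assert (Hp : 0 < p k) by (apply Rdiv_lt_0_compat; lra).
  assert (HeT : e k = T k * p k) by (unfold p; field; lra).
  pose proof (lazy_energyS k) as HeS. pose proof (lazy_bitsS k) as HbS.
  assert (Hh : harvested sigma (s + S k) = harvested sigma (s + k) + energy sigma (s + S k))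
    by (rewrite Nat.add_succ_r; reflexivity).
  pose proof (energy_pos sigma _ Ha) as HE.
  assert (Ht : t k < t (S k))
    by (unfold t; rewrite Nat.add_succ_r in *; apply time_lt, Ha).
  unfold d, Rmin in HeS, HbS. destruct (Rle_dec (T k) (t (S k) - t k)) as [Hc|Hc].
  (* The plan ends before the next arrival: [d k = T k], so all [b k] bits are sent. *)
  { left. lra. }
  right. set (D := t (S k) - t k) in *. set (E := energy sigma (s + S k)) in *.
  assert (HU : 0 < T k - D) by lra.
  pose proof (rate_pos _ Hp) as Hr.
  assert (Hb' : 0 < b (S k)) by nra.
  assert (He' : 0 < e (S k)) by nra.
  assert (Hpow : p k <= e (S k) / (T k - D)).
  { apply (Rle_div_r _ _ _ HU). nra. }
  assert (Hplan : b (S k) <= (T k - D) * rate (e (S k) / (T k - D))).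
  { replace (b (S k)) with ((T k - D) * rate (p k)) by nra.
    apply Rmult_le_compat_l; [lra|]. apply rate_le; lra. }
  destruct (lazy_duration_spec _ _ _ He' Hb' HU Hplan) as [[HT0 HTU] HTb'].
  fold (T (S k)) in HT0, HTU, HTb'. fold (p (S k)) in HTb'.
  assert (Hpp : p k <= p (S k)).
  { apply Rle_trans with (1 := Hpow). apply Rmult_le_compat_l; [lra|].
    apply Rinv_le_contravar; assumption. }
  split; [|unfold D in *; lra].
  assert (HD : 0 < D * p k) by (apply Rmult_lt_0_compat; unfold D; lra).
  unfold lazy_running. rewrite Hh.
  split; [exact Hb'|]. split; [lra|]. split; [exact HT0|]. split; [exact HTb'|].
  pose proof (rate_chord_le _ _ Hp Hpp) as Hch.
  (* Multiplying by [p k] clears denominators. [X + D * p k] is all the energy spent so far: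
     [rate_chord_le] compares efficiencies at the two powers, then the old inequality bounds the
     bits sent. *)
  apply Rmult_le_reg_l with (p k); [exact Hp|].
  rewrite HeS, HbS.
  set (X := harvested sigma (s + k) - e k) in *.
  assert (HX : 0 <= X + D * p k) by (unfold X; lra).
  apply Rle_trans with ((X + D * p k) * (p (S k) * rate (p k))).
  - replace (p k * ((harvested sigma (s + k) + E - (e k - D * p k + E)) * rate (p (S k))))
      with ((X + D * p k) * (p k * rate (p (S k)))) by (unfold X; ring).
    apply Rmult_le_compat_l; assumption.
  - replace ((X + D * p k) * (p (S k) * rate (p k)))
      with (p (S k) * (X * rate (p k) + D * p k * rate (p k))) by ring.
    replace (p k * ((B - (b k - D * rate (p k))) * p (S k)))
      with (p (S k) * ((B - b k) * p k + D * p k * rate (p k))) by ring.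
    apply Rmult_le_compat_l; lra.
Qed.

Lemma lazy_done_S (k : nat) : is_arrival sigma (s + S k) -> b k = 0 -> b (S k) = 0.
Proof.
  (* Now [T k = 0], so [p k] is a division by zero, but its rate is multiplied by [d k = 0]. *)
  intros Ha Hb. rewrite lazy_bitsS. unfold d, T. rewrite lazy_duration_done by lra.
  assert (Ht : t k < t (S k))
    by (unfold t; rewrite Nat.add_succ_r in *; apply time_lt, Ha).
  rewrite Rmin_left by lra. lra.
Qed.

Lemma lazy_running_or_done (k : nat) : is_arrival sigma (s + k) ->
  b k = 0 \/ lazy_running k.
Proof.
  induction k as [|k IH]; intros Ha.
  - right. apply lazy_running_0. rewrite Nat.add_0_r in Ha. exact Ha.
  - destruct (IH (is_arrival_le sigma (s + k) (s + S k) ltac:(lia) Ha)) as [H|H].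
    + left. apply lazy_done_S; assumption.
    + destruct (lazy_running_S k Ha H) as [|[]]; auto.
Qed.

Lemma lazy_deadline (c : R) (k j : nat) : is_arrival sigma (s + (k + j)) ->
  b k = 0 \/ lazy_running k /\ t k + T k <= c ->
  b (k + j) = 0 \/ lazy_running (k + j) /\ t (k + j) + T (k + j) <= c.
Proof.
  intros Ha Hk. induction j as [|j IH].
  - rewrite Nat.add_0_r. exact Hk.
  - rewrite Nat.add_succ_r in *.
    destruct (IH (is_arrival_le sigma (s + (k + j)) (s + S (k + j)) ltac:(lia) Ha)) as [H|[H Hc]].
    + left. apply lazy_done_S; assumption.
    + destruct (lazy_running_S _ Ha H) as [|[]]; [auto|right; split; [auto|lra]].
Qed.

Lemma lazy_duration_nonneg (k : nat) : is_arrival sigma (s + k) -> 0 <= T k.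
Proof.
  intros Ha. destruct (lazy_running_or_done k Ha) as [H|[_ [_ [H _]]]]; [|lra].
  unfold T. rewrite lazy_duration_done; lra.
Qed.

(** Ties the recursive bookkeeping of [lazy_state] to the actual power function, slot by slot. *)
Lemma lazy_bits_RInt (k : nat) : is_arrival sigma (s + k) ->
  is_RInt (fun y => rate (lazy_power sigma B s y)) 0 (t k) (B - b k).
Proof.
  induction k as [|k IH]; intros Ha.
  - assert (H0 : 0 <= t 0) by (apply time_nonneg, Ha).
    replace (B - b 0) with ((t 0 - 0) * rate 0) by (rewrite rate_0; unfold b; simpl; ring).
    eapply is_RInt_ext; [|apply (is_RInt_const (V := R_NormedModule))].
    intros y Hy. rewrite Rmin_left, Rmax_right in Hy by lra.
    unfold lazy_power. destruct (Rlt_dec y (time sigma s)) as [|Hn]; [reflexivity|].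
    unfold t in Hy. rewrite Nat.add_0_r in Hy. lra.
  - assert (Hk := is_arrival_le sigma (s + k) (s + S k) ltac:(lia) Ha).
    replace (B - b (S k)) with (plus (B - b k) (d k * rate (p k)))
      by (rewrite lazy_bitsS; unfold plus; simpl; ring).
    apply (is_RInt_Chasles (V := R_NormedModule)) with (t k); [exact (IH Hk)|].
    apply lazy_slot_RInt; [exact Hk| |intros; lra|exact (lazy_duration_nonneg k Hk)].
    apply time_le; [exact Ha|lia].
Qed.

Lemma lazy_completes (c : R) (k j : nat) : in_slot sigma c (s + (k + j)) ->
  b k = 0 \/ lazy_running k /\ t k + T k <= c ->
  exists x, 0 <= x <= c /\ is_RInt (fun y => rate (lazy_power sigma B s y)) 0 x B.
Proof.
  intros [Ha [Hc Hn]] Hk. pose proof (lazy_bits_RInt _ Ha) as HI.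
  pose proof (time_nonneg sigma _ Ha) as H0. fold (t (k + j)) in Hc, H0.
  destruct (lazy_deadline c k j Ha Hk) as [H|[[_ [_ [HT [HTb _]]]] Hd]].
  - exists (t (k + j)). split; [lra|]. rewrite H, Rminus_0_r in HI. exact HI.
  - exists (t (k + j) + T (k + j)). split; [lra|].
    assert (HI2 : is_RInt (fun y => rate (lazy_power sigma B s y))
                    (t (k + j)) (t (k + j) + T (k + j))
                    (Rmin (T (k + j)) (t (k + j) + T (k + j) - t (k + j)) * rate (p (k + j)))).
    { apply lazy_slot_RInt; [exact Ha|lra| |lra].
      (* The next arrival, if any, comes after [c], so it does not interrupt the plan. *)
      intros HS. rewrite Nat.add_succ_r in HS. specialize (Hn HS).
      unfold t. rewrite (Nat.add_succ_r s). fold (t (k + j)). lra. }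
    pose proof (is_RInt_Chasles _ _ _ _ _ _ HI HI2) as H.
    rewrite Rmin_left, HTb in H by lra. unfold plus in H; simpl in H.
    replace (B - b (k + j) + b (k + j)) with B in H by ring. exact H.
Qed.

Lemma lazy_duration_le (k : nat) (U : R) : 0 < U -> lazy_running k ->
  B <= U * rate (harvested sigma (s + k) / U) -> T k <= U.
Proof.
  intros HU [Hb [He [HT [HTb Hinv]]]] HB.
  set (h := harvested sigma (s + k)) in *.
  assert (Hp : 0 < p k) by (apply Rdiv_lt_0_compat; lra).
  assert (HeT : e k = T k * p k) by (unfold p; field; lra).
  (* Adds the efficiency inequality for past bits to [e k * rate (p k) = b k * p k] for the planned
     ones. *)
  assert (HhB : h * rate (p k) <= B * p k) by nra.
  apply Rnot_lt_le. intros Hlt.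
  assert (Hq : p k < h / U).
  { apply (Rlt_div_r _ _ _ HU). nra. }
  pose proof (rate_chord _ _ Hp Hq) as Hch.
  apply (Rmult_lt_compat_l U) in Hch; [|exact HU].
  replace (U * (h / U * rate (p k))) with (h * rate (p k)) in Hch by (field; lra).
  nra.
Qed.

Lemma lazy_two_competitive (U : R) (m : nat) : (s <= m)%nat -> 0 < U ->
  in_slot sigma U m -> B <= U * rate (harvested sigma m / U) ->
  exists x, 0 <= x <= 2 * U /\ is_RInt (fun y => rate (lazy_power sigma B s y)) 0 x B.
Proof.
  intros Hsm HU Hm HB.
  destruct (in_slot_exists sigma (2 * U)) as [n Hn]; [lra|].
  assert (Hmn : (m <= n)%nat).
  { apply (in_slot_iff sigma (2 * U) n m Hn). destruct Hm as [? [? ?]]. split; [assumption|lra]. }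
  replace n with (s + ((m - s) + (n - m)))%nat in Hn by lia.
  apply (lazy_completes _ _ _ Hn).
  destruct Hm as [Ha [Hle _]].
  replace m with (s + (m - s))%nat in Ha, Hle, HB by lia.
  destruct (lazy_running_or_done (m - s) Ha) as [H|H]; [left; exact H|right].
  (* The instant of arrival [m] and the duration planned there are each at most [U]. *)
  split; [exact H|]. pose proof (lazy_duration_le _ U HU H HB). unfold t. lra.
Qed.

End Lazy.

(** * Start of GLO and comparison with the offline optimum *)

Lemma glo_power_lazy (sigma : arrivals) (B : R) : (exists n, glo_start sigma B n) ->
  exists s, glo_start sigma B s /\ forall x, glo_power sigma B x = lazy_power sigma B s x.
Proof.
  intros H. unfold glo_power.
  destruct (excluded_middle_informative _) as [H'|]; [|contradiction].
  destruct (constructive_indefinite_description _ H') as [s Hs].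
  exists s. split; [exact Hs|reflexivity].
Qed.

(** Strong induction finds the least arrival with enough energy. *)
Lemma glo_start_exists (sigma : arrivals) (B : R) (m : nat) : is_arrival sigma m ->
  Rbar_lt B (sendable sigma m) -> exists s, glo_start sigma B s.
Proof.
  induction m as [m IH] using (well_founded_induction Wf_nat.lt_wf). intros Ha Hm.
  destruct (classic (exists n, (n < m)%nat /\ Rbar_lt B (sendable sigma n)))
    as [[n [Hn HB]]|Hno].
  - apply (IH n Hn); [|exact HB]. apply (is_arrival_le sigma n m); [lia|exact Ha].
  - exists m. repeat split; [exact Ha|exact Hm|].
    intros n Hn. apply Rbar_not_lt_le. intros HB. apply Hno. exists n. auto.
Qed.

Lemma glo_time_le (sigma : arrivals) (B : R) (P : R -> R) (U : R) : 0 < B ->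
  power_profile P -> feasible sigma P -> 0 <= U -> B <= bits_sent P U ->
  Rbar_le (glo_time sigma B) (2 * U).
Proof.
  intros HB HP HF HU0 HBU.
  assert (HU : 0 < U).
  { destruct HU0 as [|<-]; [assumption|]. unfold bits_sent in HBU.
    rewrite RInt_point in HBU. unfold zero in HBU; simpl in HBU. lra. }
  destruct (in_slot_exists sigma U HU0) as [m Hm]. pose proof Hm as [Ha _].
  pose proof (harvested_pos sigma m Ha) as Hh.
  assert (Hplan : B <= U * rate (harvested sigma m / U)).
  { apply Rle_trans with (1 := HBU), bits_sent_le; try assumption.
    rewrite <- (harvested_by_slot sigma U m Hm). apply HF, HU0. }
  (* The energy that let the offline profile finish by [U] also suffices for GLO to start, no later
     than arrival [m]. *)
  assert (Hsend : Rbar_lt B (sendable sigma m)).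
  { rewrite sendable_eq by exact Hh.
    apply Rle_lt_trans with (1 := Hplan), planned_bits_lt_sendable; assumption. }
  destruct (glo_power_lazy sigma B (glo_start_exists sigma B m Ha Hsend))
    as [s [[Hs [HsB Hmin]] Hpow]].
  assert (Hsm : (s <= m)%nat).
  { destruct (Nat.le_gt_cases s m) as [|Hlt]; [assumption|].
    exfalso. exact (Rbar_lt_not_le _ _ Hsend (Hmin m Hlt)). }
  rewrite sendable_eq in HsB by (apply harvested_pos, Hs).
  destruct (lazy_two_competitive sigma B s HB HsB U m Hsm HU Hm Hplan) as [x [Hx HI]].
  apply Rbar_le_trans with (Finite x); [|simpl; lra].
  apply (proj1 (Glb_Rbar_correct _)). split; [lra|].
  unfold bits_sent. rewrite (RInt_ext _ (fun y => rate (lazy_power sigma B s y))).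
  - rewrite (is_RInt_unique _ _ _ _ HI). lra.
  - intros y _. rewrite Hpow. reflexivity.
Qed.

Theorem theorem4 (sigma : user -> arrivals) (B : user -> R) (u : user)
  (hB : 0 < B u)
  (hT : Rbar_lt (offline_time (sigma u) (B u)) p_infty) :
  Rbar_le (glo_time (sigma u) (B u))
          (Rbar_mult (Finite 2) (offline_time (sigma u) (B u))).
Proof.
  (* Halving inside [Rbar] turns the bound by [2 * U] into a lower bound on every [U], which passes
     through both infima: over instants with [B] bits sent, then over profiles. *)
  set (half := match glo_time (sigma u) (B u) with Finite r => Finite (r / 2) | x => x end).
  assert (Hhalf : Rbar_le half (offline_time (sigma u) (B u))).
  { apply Glb_Rbar_correct. intros T [P [HP [HF HT]]]. rewrite <- HT.
    apply Glb_Rbar_correct. intros U [HU HBU].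
    pose proof (glo_time_le _ _ P U hB HP HF HU HBU) as H.
    unfold half. destruct (glo_time (sigma u) (B u)); simpl in *; try tauto. lra. }
  unfold half in Hhalf.
  destruct (offline_time (sigma u) (B u)) as [r| |]; [|contradiction|].
  - destruct (glo_time (sigma u) (B u)); simpl in *; try tauto. lra.
  - destruct (glo_time (sigma u) (B u)); simpl in *; tauto.
Qed.
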